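(* Let $n\ge 1$ be an integer. Then: (i) $(6n-5) \sigma(n) \equiv \sigma_3(n) \pmod{24}$ if $\gcd(n,6)=1$; (ii) $\sigma(n)+2n\sigma_3(n) \equiv 3 \sigma_5(n) \pmod{16}$ if $2\nmid n$; (iii) $n\sigma(n)+5n\sigma_7(n) \equiv 6n^2\sigma_5(n) \pmod{2^3\cdot 3^2\cdot 7}$ if $\gcd(n, 42)=1$; (iv) $20 \sigma_7(n)+11\sigma_9(n) \equiv \sigma(n)+30n\sigma_7(n) \pmod{2^5\cdot 3\cdot5}$ (for all $n$); (v) $5 \sigma(n)+6n\sigma_7(n) \equiv 11\sigma_9(n) \pmod{2^5}$ if $2\nmid n$; (vi) $\sigma(n)+2n\sigma_3(n) \equiv 3\sigma_5(n) \pmod{2^4\cdot5}$ if $\gcd(n,10)=1$; (vii) $\sigma(n)+10(3n-2)\sigma_7(n) \equiv 11\sigma_9(n) \pmod{2^3\cdot3\cdot5}$ if $\gcd(n, 30)=1$.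
   Context: For $k\ge 1$, $\sigma_k(n)=\sum_{d\mid n} d^k$ (sum over positive divisors of $n$), and $\sigma(n)=\sigma_1(n)$. *)

(* Defs.v *)
From mathcomp Require Import all_boot all_order all_algebra.

Set Implicit Arguments.
Unset Strict Implicit.
Unset Printing Implicit Defensive.

Definition sigma (k n : nat) : nat := \sum_(d <- divisors n) d ^ k.

(* Main.v *)
(** Write [e = n/d]. In each congruence the difference of the two sides is a sum
    over the divisors [d] of [n] of a polynomial [F(d, e)], and Fermat-Euler
    congruences [d^k = 1] reduce [F(d, e)] to an antisymmetric polynomial in
    [d] and [e]; such a polynomial sums to zero because [d <-> e] permutes the
    divisors. Only in (iv), when [n] is even, do the even divisors [d = 2k]
    need a correction [30 (e - k)]: as [k] runs over the divisors of [n/2],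
    with codivisor [e], this too is antisymmetric. *)
Require Import Defs.
From mathcomp Require Import all_boot all_order all_algebra.
From mathcomp Require Import cyclic ring zify.

Set Implicit Arguments.
Unset Strict Implicit.
Unset Printing Implicit Defensive.

Import GRing.Theory.
Local Open Scope ring_scope.

(** * Sums over divisors and the involution [d |-> n / d] *)

Lemma perm_codivisors (n : nat) : (0 < n)%N ->
  perm_eq [seq (n %/ d)%N | d <- divisors n] (divisors n).
Proof.
move=> n_gt0.
have codivK d : d \in divisors n -> (n %/ (n %/ d))%N = d.
  by rewrite -dvdn_divisors // => d_n; rewrite divnA // mulKn.
have codiv_dvd d : d \in divisors n -> (n %/ d)%N \in divisors n.
  by rewrite -!dvdn_divisors // => d_n; rewrite dvdn_div.
apply: uniq_perm.
- rewrite map_inj_in_uniq ?divisors_uniq // => d d' d_n d'_n eq_dd'.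
  by rewrite -(codivK d d_n) -(codivK d' d'_n) eq_dd'.
- exact: divisors_uniq.
move=> d; apply/mapP/idP => [[d' d'_n ->]|d_n]; first exact: codiv_dvd.
by exists (n %/ d)%N; [exact: codiv_dvd | rewrite codivK].
Qed.

Lemma sum_divisors_antisym (n : nat) (G : nat -> nat -> int) :
    (0 < n)%N -> (forall d e, G e d = - G d e) ->
  \sum_(d <- divisors n) G d (n %/ d)%N = 0.
Proof.
move=> n_gt0 G_antisym; set S := \sum_(_ <- _) _.
suff: S = - S by lia.
rewrite {1}/S -(perm_big _ (perm_codivisors n_gt0)) big_map -sumrN.
apply: eq_big_seq => d; rewrite -dvdn_divisors // => d_n.
by rewrite divnA // mulKn // G_antisym.
Qed.

Lemma sum_even_divisors (m : nat) (f : nat -> int) : (0 < m)%N ->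
  \sum_(d <- divisors (2 * m) | (2 %| d)%N) f d
    = \sum_(k <- divisors m) f (2 * k)%N.
Proof.
move=> m_gt0; rewrite -big_filter.
rewrite -(big_map (fun k => 2 * k)%N predT f); apply: perm_big.
apply: uniq_perm; rewrite ?filter_uniq ?divisors_uniq //.
  rewrite map_inj_uniq ?divisors_uniq // => k k' /eqP.
  by rewrite eqn_pmul2l // => /eqP.
move=> d; rewrite mem_filter -dvdn_divisors ?muln_gt0 //.
apply/andP/mapP => [[/dvdnP [k ->]]|[k]].
  rewrite mulnC dvdn_pmul2l // => k_m.
  by exists k; rewrite -?dvdn_divisors.
by rewrite -dvdn_divisors // => k_m ->; rewrite dvdn_mulr // dvdn_pmul2l.
Qed.

Lemma dvdz_sum_divisors (m : int) (n : nat) (F : nat -> int) :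
    (0 < n)%N ->
    (forall d e, (d * e)%N = n -> (n %/ d)%N = e -> (m %| F d)%Z) ->
  (m %| \sum_(d <- divisors n) F d)%Z.
Proof.
move=> n_gt0 m_F; rewrite big_seq_cond.
apply: (big_ind (fun x => m %| x)%Z) => [|x y|d]; first exact: dvdz0.
  exact: rpredD.
rewrite andbT -dvdn_divisors // => d_n.
by apply: (m_F d (n %/ d)%N) => //; rewrite mulnC divnK.
Qed.

(** Since [G] sums to zero, it may be subtracted termwise for free; divisibility is then checked one
    divisor at a time. *)
Lemma dvdz_sum_divisors_antisym (m : int) (n : nat) (F : nat -> int)
    (G : nat -> nat -> int) :
    (0 < n)%N -> (forall d e, G e d = - G d e) ->
    (forall d e, (d * e)%N = n -> (m %| F d - G d e)%Z) ->
  (m %| \sum_(d <- divisors n) F d)%Z.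
Proof.
move=> n_gt0 G_antisym m_FG.
have := sum_divisors_antisym n_gt0 G_antisym => sumG.
have -> : \sum_(d <- divisors n) F d
    = \sum_(d <- divisors n) (F d - G d (n %/ d)%N).
  by rewrite sumrB sumG subr0.
apply: dvdz_sum_divisors => // d e de_n codivE.
by rewrite codivE; exact: m_FG.
Qed.

(** * Fermat-Euler congruences for powers of a divisor *)

Lemma PoszX (a k : nat) : (a ^ k)%N%:Z = a%:Z ^+ k.
Proof. by elim: k => // k IHk; rewrite expnS exprS PoszM IHk. Qed.

Lemma sigmaz (k n : nat) :
  (sigma k n)%:Z = \sum_(d <- divisors n) d%:Z ^+ k.
Proof.
rewrite /sigma (big_morph Posz PoszD (erefl _)).
by apply: eq_bigr => d _; rewrite PoszX.
Qed.

Lemma eqn_mod_dvdz (q a b : nat) :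
  (a = b %[mod q])%N -> (q%:Z %| a%:Z - b%:Z)%Z.
Proof. by move=> ab; rewrite -eqz_mod_dvd !modz_nat ab. Qed.

Lemma dvdz_fermat (p d : nat) : prime p -> (p%:Z %| d%:Z ^+ p - d%:Z)%Z.
Proof.
move=> p_pr; have := eqn_mod_dvdz (fermat_little d p_pr).
by rewrite PoszX.
Qed.

Lemma dvdz_euler (q d : nat) : coprime d q ->
  (q%:Z %| d%:Z ^+ totient q - 1)%Z.
Proof.
move=> d_q; have := eqn_mod_dvdz (Euler_exp_totient d_q).
by rewrite PoszX.
Qed.

Lemma odd_sqr_mod8 (d : nat) : odd d -> (8 %| d%:Z ^+ 2 - 1)%Z.
Proof.
move=> d_odd; have := odd_double_half d; rewrite d_odd => <-.
have /dvdzP [t tE] := dvdz_fermat d./2 (isT : prime 2).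
(* With [d = 2h + 1] and [h^2 - h = 2t], [d^2 - 1 = 4(h^2 - h) + 8h = 8(t + h)]. *)
by apply/dvdzP; exists (t + d./2%:Z); lia.
Qed.

(** Squaring [1 + 8t] gains a factor 2: [(1 + 8t)^2 = 1 + 16 t (4t + 1)]. Euler's theorem would only
    give the exponent 8. *)
Lemma odd_exp4_mod16 (d : nat) : odd d -> (16 %| d%:Z ^+ 4 - 1)%Z.
Proof.
move=> /odd_sqr_mod8 /dvdzP [t tE]; apply/dvdzP; exists (t * (4 * t + 1)).
have -> : d%:Z ^+ 4 = (d%:Z ^+ 2 - 1 + 1) ^+ 2 by ring.
by rewrite tE; ring.
Qed.

Lemma odd_exp8_mod32 (d : nat) : odd d -> (32 %| d%:Z ^+ 8 - 1)%Z.
Proof.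
move=> /odd_exp4_mod16 /dvdzP [t tE]; apply/dvdzP; exists (t * (8 * t + 1)).
have -> : d%:Z ^+ 8 = (d%:Z ^+ 4 - 1 + 1) ^+ 2 by ring.
by rewrite tE; ring.
Qed.

Lemma sqr_mod24 (d : nat) : coprime d 6 -> (24 %| d%:Z ^+ 2 - 1)%Z.
Proof.
rewrite (coprimeMr d 2 3) coprimen2 => /andP [d_odd d_3].
rewrite (@Gauss_dvdz 8 3) // odd_sqr_mod8 //.
exact: (dvdz_euler d_3).
Qed.

(** [504 = 8 * 9 * 7]: the totients of 9 and 7 are both 6, and modulo 8 already [d^2 = 1]. *)
Lemma exp6_mod504 (d : nat) : coprime d 42 -> (504 %| d%:Z ^+ 6 - 1)%Z.
Proof.
rewrite (coprimeMr d 6 7) (coprimeMr d 2 3) coprimen2.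
case/andP=> /andP [d_odd d_3] d_7.
rewrite (@Gauss_dvdz 72 7) // (@Gauss_dvdz 8 9) //.
have d_9 : coprime d 9 by rewrite (coprimeMr d 3 3) d_3.
rewrite (dvdz_euler d_7) (dvdz_euler d_9) !andbT.
have -> : d%:Z ^+ 6 - 1 = (d%:Z ^+ 4 + d%:Z ^+ 2 + 1) * (d%:Z ^+ 2 - 1).
  by ring.
by rewrite dvdz_mull // odd_sqr_mod8.
Qed.

Lemma exp4_mod80 (d : nat) : coprime d 10 -> (80 %| d%:Z ^+ 4 - 1)%Z.
Proof.
rewrite (coprimeMr d 2 5) coprimen2 => /andP [d_odd d_5].
by rewrite (@Gauss_dvdz 16 5) // odd_exp4_mod16 // (dvdz_euler d_5).
Qed.

(** Both [d^3 - d] and [d^5 - d] divide [d^9 - d], because 2 and 4 divide 8. *)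
Lemma dvdz15_exp9B (d : nat) : (15 %| d%:Z ^+ 9 - d%:Z)%Z.
Proof.
rewrite (@Gauss_dvdz 3 5) //; apply/andP; split.
  have -> : d%:Z ^+ 9 - d%:Z
    = (d%:Z ^+ 6 + d%:Z ^+ 4 + d%:Z ^+ 2 + 1) * (d%:Z ^+ 3 - d%:Z) by ring.
  by rewrite dvdz_mull // (@dvdz_fermat 3).
have -> : d%:Z ^+ 9 - d%:Z = (d%:Z ^+ 4 + 1) * (d%:Z ^+ 5 - d%:Z) by ring.
by rewrite dvdz_mull // (@dvdz_fermat 5).
Qed.

(** * The congruence modulo [480 = 2^5 * 3 * 5], by parity of the divisor *)

Lemma odd_divisor_mod480 (e : int) (d : nat) : odd d ->
  (480 %| 20 * d%:Z ^+ 7 + 11 * d%:Z ^+ 9 - d%:Z - 30 * (d%:Z * e) * d%:Z ^+ 7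
          - 30 * (d%:Z - e))%Z.
Proof.
move=> d_odd.
have /dvdzP [u uE] := odd_exp8_mod32 d_odd.
have /dvdzP [v vE] : (24 %| d%:Z * (d%:Z ^+ 2 - 1))%Z.
  rewrite (@Gauss_dvdz 8 3) // dvdz_mull ?odd_sqr_mod8 //=.
  have -> : d%:Z * (d%:Z ^+ 2 - 1) = d%:Z ^+ 3 - d%:Z by ring.
  exact: (@dvdz_fermat 3).
have /dvdzP [w wE] : (480 %| d%:Z * (d%:Z ^+ 8 - 1))%Z.
  rewrite (@Gauss_dvdz 32 15) // dvdz_mull ?odd_exp8_mod32 //=.
  have -> : d%:Z * (d%:Z ^+ 8 - 1) = d%:Z ^+ 9 - d%:Z by ring.
  exact: dvdz15_exp9B.
apply/dvdzP; exists (- 2 * e * u + v * (d%:Z ^+ 4 + d%:Z ^+ 2 + 1) + 11 * w).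
(* The three summands encode [30 e d^8 = 30 e], [20 d^7 = 20 d] and [11 d^9 = 11 d] modulo 480; what
   is left is [30 (d - e)]. *)
have -> : 20 * d%:Z ^+ 7 + 11 * d%:Z ^+ 9 - d%:Z - 30 * (d%:Z * e) * d%:Z ^+ 7
          - 30 * (d%:Z - e)
  = - 30 * e * (d%:Z ^+ 8 - 1)
    + 20 * (d%:Z ^+ 4 + d%:Z ^+ 2 + 1) * (d%:Z * (d%:Z ^+ 2 - 1))
    + 11 * (d%:Z * (d%:Z ^+ 8 - 1)) by ring.
by rewrite wE vE uE; ring.
Qed.

(** The two subtracted terms add up to [30 k], which turns [- d = - 2k] into [- 32k], so 32 divides
    every term. Modulo 15, [k^9 = k] and [80 k^7 = 80 k] leave multiples of [255 = 15 * 17] and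
    [240 = 15 * 16]. *)
Lemma even_divisor_mod480 (e : int) (k : nat) :
  let d := 2 * k%:Z in
  (480 %| 20 * d ^+ 7 + 11 * d ^+ 9 - d - 30 * (d * e) * d ^+ 7
          - 30 * (d - e) - 30 * (e - k%:Z))%Z.
Proof.
cbv zeta.
have /dvdzP [w wE] := dvdz15_exp9B k.
have /dvdzP [v vE] := dvdz_fermat k (isT : prime 3).
apply/dvdzP.
exists (176 * w + 16 * v * (k%:Z ^+ 4 + k%:Z ^+ 2 + 1) + 17 * k%:Z
        - 16 * k%:Z ^+ 8 * e).
transitivity (32 * (176 * (k%:Z ^+ 9 - k%:Z)
    + 80 * (k%:Z ^+ 4 + k%:Z ^+ 2 + 1) * (k%:Z ^+ 3 - k%:Z)
    + 255 * k%:Z - 240 * k%:Z ^+ 8 * e)); first by ring.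
by rewrite wE vE; ring.
Qed.

Lemma sum_even_divisors_antisym (n : nat) : (0 < n)%N ->
  \sum_(d <- divisors n | (2 %| d)%N) ((n %/ d)%N%:Z - d./2%:Z) = 0.
Proof.
move=> n_gt0; have [/dvdnP [m nE]|n_odd] := boolP (2 %| n)%N; last first.
  rewrite big_seq_cond big_pred0 // => d.
  apply/negP => /andP []; rewrite -dvdn_divisors // => d_n d_even.
  by move: n_odd; rewrite (dvdn_trans d_even d_n).
have m_gt0 : (0 < m)%N by move: n_gt0; rewrite nE; case: (m).
rewrite nE mulnC sum_even_divisors //.
(* The codivisor of [2k] in [2m] is [m / k], so the sum runs over [m / k - k] for [k] dividing
   [m]. *)
rewrite -[RHS](sum_divisors_antisym (G := fun d e => e%:Z - d%:Z) m_gt0).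
  by apply: eq_bigr => k _; rewrite divnMl // mul2n doubleK.
by move=> d e; rewrite opprB.
Qed.

Lemma sigma_7_9_mod480 (n : nat) : (0 < n)%N ->
  (480 %| 20 * (sigma 7 n)%:Z + 11 * (sigma 9 n)%:Z
          - ((sigma 1 n)%:Z + 30 * n%:Z * (sigma 7 n)%:Z))%Z.
Proof.
move=> n_gt0.
(* [A] is the antisymmetric part for all divisors, [B] the correction at even ones; both sum to
   zero. *)
pose A d := 30 * (d%:Z - (n %/ d)%N%:Z).
pose B d := if (2 %| d)%N then 30 * ((n %/ d)%N%:Z - d./2%:Z) else 0.
have sumA : \sum_(d <- divisors n) A d = 0.
  rewrite (sum_divisors_antisym (G := fun d e => 30 * (d%:Z - e%:Z))) //.
  by move=> d e; ring.
have sumB : \sum_(d <- divisors n) B d = 0.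
  by rewrite -big_mkcond -mulr_sumr sum_even_divisors_antisym // mulr0.
rewrite !sigmaz !mulr_sumr -!big_split -sumrB /=; set S := \sum_(_ <- _) _.
have <- : S - \sum_(d <- divisors n) A d - \sum_(d <- divisors n) B d = S.
  by rewrite sumA sumB !subr0.
rewrite -!sumrB; apply: dvdz_sum_divisors => // d e de_n codivE.
rewrite /A /B codivE -de_n PoszM; case: ifPn => [/dvdnP [k ->]|].
  have := even_divisor_mod480 e%:Z k; rewrite muln2 doubleK -mul2n PoszM.
  by congr (_ %| _)%Z; ring.
rewrite dvdn2 negbK => /(odd_divisor_mod480 e%:Z).
by congr (_ %| _)%Z; ring.
Qed.

Theorem corollary2p12 (n : nat) (hn : (1 <= n)%N) :
  let N : int := n%:Z in
  let s (k : nat) : int := (sigma k n)%:Z in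
  (gcdn n 6 = 1%N ->
     ((6 * N - 5) * s 1%N = s 3%N %[mod 24])%Z) /\
  (~~ (2 %| n)%N ->
     (s 1%N + 2 * N * s 3%N = 3 * s 5%N %[mod 16])%Z) /\
  (gcdn n 42 = 1%N ->
     (N * s 1%N + 5 * N * s 7%N = 6 * N ^+ 2 * s 5%N
        %[mod 2 ^+ 3 * 3 ^+ 2 * 7])%Z) /\
  (20 * s 7%N + 11 * s 9%N = s 1%N + 30 * N * s 7%N
     %[mod 2 ^+ 5 * 3 * 5])%Z /\
  (~~ (2 %| n)%N ->
     (5 * s 1%N + 6 * N * s 7%N = 11 * s 9%N %[mod 2 ^+ 5])%Z) /\
  (gcdn n 10 = 1%N ->
     (s 1%N + 2 * N * s 3%N = 3 * s 5%N %[mod 2 ^+ 4 * 5])%Z) /\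
  (gcdn n 30 = 1%N ->
     (s 1%N + 10 * (3 * N - 2) * s 7%N = 11 * s 9%N
        %[mod 2 ^+ 3 * 3 * 5])%Z).
Proof.
move=> N s; rewrite {}/s {}/N.
have dvd_coprime d e q : (d * e)%N = n -> gcdn n q = 1%N -> coprime d q.
  by move=> <- /eqP; rewrite -/(coprime _ _) coprimeMl => /andP [].
have odd_dvd d e : (d * e)%N = n -> ~~ (2 %| n)%N -> odd d.
  by move=> <-; rewrite dvdn2 negbK oddM => /andP [].
do 6?split; try move=> n_q; apply/eqP; rewrite eqz_mod_dvd.
- rewrite !sigmaz !mulr_sumr -?big_split -sumrB /=.
  (* With [n = d e] the term is [6 d^2 e - 5 d - d^3]; putting [d^2 = 1] gives [6 (e - d)]. The
     witness below is the quotient of the difference by [d^2 - 1]. Items (ii), (iii), (v) and (vi)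
     follow the same pattern with [d^4], [d^6], [d^8] and [d^4]. *)
  apply: (@dvdz_sum_divisors_antisym _ _ _
    (fun d e => 6 * (e%:Z - d%:Z))) => // [d e|d e de_n]; first by ring.
  apply: (dvdz_trans (sqr_mod24 (dvd_coprime d e 6%N de_n n_q))).
  apply/dvdzP; exists (6 * e%:Z - d%:Z).
  by rewrite -de_n PoszM; ring.
- rewrite !sigmaz !mulr_sumr -?big_split -sumrB /=.
  apply: (@dvdz_sum_divisors_antisym _ _ _
    (fun d e => 2 * (e%:Z - d%:Z))) => // [d e|d e de_n]; first by ring.
  apply: (dvdz_trans (odd_exp4_mod16 (odd_dvd d e de_n n_q))).
  apply/dvdzP; exists (2 * e%:Z - 3 * d%:Z).
  by rewrite -de_n PoszM; ring.
- rewrite !sigmaz !mulr_sumr -?big_split -sumrB /=.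
  apply: (@dvdz_sum_divisors_antisym _ _ _
    (fun d e => 6 * (d%:Z * e%:Z) * (d%:Z - e%:Z))) => // [d e|d e de_n].
    by ring.
  apply: (dvdz_trans (exp6_mod504 (dvd_coprime d e 42%N de_n n_q))).
  apply/dvdzP; exists (5 * d%:Z ^+ 2 * e%:Z - 6 * d%:Z * e%:Z ^+ 2).
  by rewrite -de_n PoszM; ring.
- exact: sigma_7_9_mod480.
- rewrite !sigmaz !mulr_sumr -?big_split -sumrB /=.
  apply: (@dvdz_sum_divisors_antisym _ _ _
    (fun d e => 6 * (e%:Z - d%:Z))) => // [d e|d e de_n]; first by ring.
  apply: (dvdz_trans (odd_exp8_mod32 (odd_dvd d e de_n n_q))).
  apply/dvdzP; exists (6 * e%:Z - 11 * d%:Z).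
  by rewrite -de_n PoszM; ring.
- rewrite !sigmaz !mulr_sumr -?big_split -sumrB /=.
  apply: (@dvdz_sum_divisors_antisym _ _ _
    (fun d e => 2 * (e%:Z - d%:Z))) => // [d e|d e de_n]; first by ring.
  apply: (dvdz_trans (exp4_mod80 (dvd_coprime d e 10%N de_n n_q))).
  apply/dvdzP; exists (2 * e%:Z - 3 * d%:Z).
  by rewrite -de_n PoszM; ring.
(* The difference in (vii) is the negative of that in (iv), and [480 = 4 * 120]. *)
- have /dvdzP [t tE] := sigma_7_9_mod480 hn.
  apply/dvdzP; exists (- 4 * t).
  rewrite -[2 ^+ 3 * 3 * 5]/(120 : int).
  transitivity (- (t * 480)); last by ring.
  by rewrite -tE; ring.
Qed.
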